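(* Let $\theta\ge 2$ be an integer and let $d$ be an integer with $d>2(1+\theta)$. Put $$T(\theta,d)=\frac{2\theta\log(\theta)}{(\theta-1)(d-2(1+\theta))}.$$ For every $t>T(\theta,d)$ there exist $\epsilon>0$ and $\eta>0$ such that $$p_{n,d}\left(\mathbb{P}_{\theta,t}(A_{\eta})\ge \epsilon\right)\longrightarrow 1\quad\text{as } n\to\infty,$$ where $p_{n,d}$ is the law of the random underlying graph $G=(V,E)$, $\mathbb{P}_{\theta,t}$ is the weighted interchange measure on $G$, and $A_\eta$ is the event that the permutation $X_t$ has a cycle of size larger than $\eta|V|$.
   Context: Random graph: $p_{n,d}$ denotes the uniform probability measure on (simple) $d$-regular graphs with $n$ vertices, i.e. graphs on vertex set $V=\{1,\dots,n\}$ in which every vertex has degree $d$; limits $n\to\infty$ are taken along $n$ with $nd$ even. Interchange process: for a finite graph $G=(V,E)$, $(X_t)_{t\ge 0}$ is the continuous-time Markov jump process on the set of permutations of $V$, started at the identity permutation $X_0=\mathrm{id}$, which for each edge $\{x,y\}\in E$ jumps from $\sigma$ to $\tau_{\{x,y\}}\cdot\sigma$ at rate $1$. Here $\tau_{\{x,y\}}$ is the transposition exchanging $x$ and $y$, and $(\sigma_1\cdot\sigma_2)(x)=\sigma_1(\sigma_2(x))$. $\mathbb{E}$ is the expectation with respect to this process on the fixed graph $G$. Weighted measure: $N(\sigma)$ is the number of cycles of a permutation $\sigma$ (fixed points count as cycles). For $\theta\in(0,\infty)$ and $t\ge 0$, $$Z_\theta(t)=\mathbb{E}\left(\theta^{N(X_t)}\right),\qquad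 \mathbb{P}_{\theta,t}(A)=\frac{1}{Z_\theta(t)}\mathbb{E}\left(\theta^{N(X_t)}1_A\right).$$ Under $p_{n,d}$, the quantity $\mathbb{P}_{\theta,t}(A_\eta)$ is a random variable depending on the random graph $G$. *)

(* Defs.v *)
From HB Require Import structures.
From mathcomp Require Import all_boot all_order all_algebra all_fingroup.
From mathcomp Require Import all_classical all_reals all_analysis.

Set Implicit Arguments.
Unset Strict Implicit.
Unset Printing Implicit Defensive.

Import Order.TTheory GRing.Theory Num.Theory.
Import numFieldNormedType.Exports.

Local Open Scope classical_set_scope.
Local Open Scope ring_scope.

(* A finite simple graph on V is given by its edges, which are 2-element
   subsets of V. *)
Record sgraph (V : finType) : Type := SGraph {
  edges :> {set {set V}};
  edges_card2 : [forall e in edges, #|e| == 2%N] }.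

HB.instance Definition _ (V : finType) := [isSub for @edges V].
HB.instance Definition _ (V : finType) := [Countable of sgraph V by <:].
HB.instance Definition _ (V : finType) := [Finite of sgraph V by <:].

Definition degree (V : finType) (G : sgraph V) (v : V) : nat :=
  #|[set e in edges G | v \in e]%SET|.

Definition regular (V : finType) (d : nat) (G : sgraph V) : bool :=
  [forall v, degree G v == d].

(* The probability of the event A under the uniform measure on d-regular graphs
   with n vertices.  It has the junk value 0 if there are no such graphs. *)
Definition p_regular (R : realType) (n d : nat) (A : {set sgraph 'I_n}) : R :=
  #|[set G in A | regular d G]%SET|%:R / #|[set G : sgraph 'I_n | regular d G]%SET|%:R.

(* The transposition exchanging the two endpoints of e (see edge_tpermE); the
   choice of an ordering of the endpoints is irrelevant by tpermC. *)
Definition edge_tperm (V : finType) (e : {set V}) : {perm V} :=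
  if [pick p : V * V | e == [set p.1; p.2]%SET] is Some p
  then tperm p.1 p.2 else 1%g.

Lemma edge_tpermE (V : finType) (x y : V) :
  edge_tperm [set x; y]%SET = tperm x y.
Proof.
rewrite /edge_tperm; case: pickP => [[a b] /= /eqP exy|/(_ (x, y))]; last first.
  by rewrite /= eqxx.
have : a \in [set x; y]%SET by rewrite exy set21.
have : b \in [set x; y]%SET by rewrite exy set22.
have : x \in [set a; b]%SET by rewrite -exy set21.
have : y \in [set a; b]%SET by rewrite -exy set22.
rewrite !in_set2.
by do 4![case/orP => /eqP ?]; subst; rewrite ?tperm1 // tpermC.
Qed.

(* Transition functions, on a finite state space S, of time-homogeneous Markov
   processes. *)
Record transition_function (R : realType) (S : finType)
    (p : R -> S -> S -> R) : Prop := TransitionFunction {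
  tf_ge0 : forall h x y, 0 <= h -> 0 <= p h x y;
  tf_sum1 : forall h x, 0 <= h -> \sum_y p h x y = 1;
  tf_0 : forall x y, p 0 x y = (x == y)%:R;
  tf_chapman_kolmogorov : forall g h x z, 0 <= g -> 0 <= h ->
    p (g + h) x z = \sum_y p g x y * p h y z }.

(* X is a continuous-time Markov jump process on the finite set S, started at
   x0, which jumps from x to y != x at rate q x y, i.e. the probability of going
   from x to y in time h is q x y * h + o(h).  Only the times t >= 0 matter, and
   the diagonal of q is ignored.  On a finite discrete S, right-continuous paths
   with left limits are the step functions with finitely many jumps in every
   bounded interval. *)
Record markov_jump_process (R : realType) (S : finType) (q : S -> S -> R)
    (x0 : S) (d : measure_display) (Omega : measurableType d)
    (P : probability Omega R) (X : R -> Omega -> S) : Prop :=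
  MarkovJumpProcess {
  mjp_measurable : forall t x, 0 <= t -> measurable (X t @^-1` [set x]);
  mjp_start : forall w, X 0 w = x0;
  mjp_right_continuous : forall w t, 0 <= t ->
    \forall h \near 0^'+, X (t + h) w = X t w;
  mjp_left_limit : forall w t, 0 < t ->
    exists x, \forall h \near 0^'+, X (t - h) w = x;
  mjp_markov : exists p : R -> S -> S -> R,
    [/\ transition_function p,
        forall x y, x != y -> p h x y / h @[h --> 0^'+] --> q x y
      & forall (k : nat) (s : nat -> R) (x : nat -> S) (h : R) (y : S),
          0 <= s 0 -> {homo s : i j / (i <= j)%N >-> i <= j} -> 0 <= h ->
          P ((\bigcap_(i in [set i | (i <= k)%N]) X (s i) @^-1` [set x i])
               `&` X (s k + h) @^-1` [set y])
          = (P (\bigcap_(i in [set i | (i <= k)%N]) X (s i) @^-1` [set x i])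
               * (p h (x k) y)%:E)%E] }.

(* Each edge e contributes rate 1 to the jump from sigma to tau_e . sigma, where
   (s1 . s2)(x) = s1 (s2 x); this product is s2 * s1 in MathComp (permM). *)
Definition interchange_rate (R : realType) (V : finType) (G : sgraph V)
    (sigma sigma' : {perm V}) : R :=
  #|[set e in edges G | sigma' == (sigma * edge_tperm e)%g]%SET|%:R.

Record interchange_process (R : realType) (V : finType) (G : sgraph V) : Type :=
  InterchangeProcess {
  ip_display : measure_display;
  ip_space : measurableType ip_display;
  ip_prob : probability ip_space R;
  ip_path : R -> ip_space -> {perm V};
  ip_markov :
    markov_jump_process (interchange_rate R G) 1%g ip_prob ip_path }.

Arguments ip_prob {R V G}.
Arguments ip_path {R V G}.

Definition ncycles (V : finType) (sigma : {perm V}) : nat := #|porbits sigma|.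

Section weighted_measure.
Variables (R : realType) (V : finType) (G : sgraph V).
Variable X : interchange_process R G.

Definition partition_function (theta t : R) : R :=
  fine 'E_(ip_prob X)[fun w => theta ^+ ncycles (ip_path X t w)].

Definition weighted_prob (theta t : R) (A : set (ip_space X)) : R :=
  (partition_function theta t)^-1 *
  fine 'E_(ip_prob X)[fun w => theta ^+ ncycles (ip_path X t w) * \1_A w].

Definition large_cycle (t eta : R) : set (ip_space X) :=
  [set w | exists2 C, C \in porbits (ip_path X t w)
                    & eta * #|V|%:R < #|C|%:R].

End weighted_measure.

Arguments weighted_prob {R V G}.
Arguments large_cycle {R V G}.

Definition T_threshold (R : realType) (theta d : nat) : R :=
  2 * theta%:R * ln theta%:R /
  ((theta%:R - 1) * (d%:R - 2 * (1 + theta%:R))).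

(* Main.v *)
Require Import Defs.
From mathcomp Require Import all_boot all_order all_algebra all_fingroup.
From mathcomp Require Import all_classical all_reals all_analysis.
From mathcomp Require Import measurable_realfun.
From mathcomp Require Import ring lra zify.
Import Order.TTheory GRing.Theory Num.Theory.
Import numFieldNormedType.Exports.
Local Open Scope classical_set_scope.
Local Open Scope ring_scope.

Set Implicit Arguments.
Unset Strict Implicit.
Unset Printing Implicit Defensive.

(** The weight theta^N, where N is the number of cycles, is the number of
    colourings of the vertices with theta colours that the permutation fixes.
    Hence Z(t) = E theta^N(X_t) is the trace of the mean of the permutation
    matrices by which X_t acts on colourings.  The rates are symmetric, so these
    mean matrices form a semigroup of symmetric matrices, and the Cauchy-Schwarz
    inequality for them gives Z(s + r)^2 <= Z(2s) Z(2r): the partition function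
    is log-convex ([fix_mean_log_convex]).  With n vertices,
    ln Z(0) = n ln theta and ln Z(t) >= 0, so convexity bounds the logarithmic
    derivative at time t itself from below ([fix_mean_slope]):
      t Z'(t) / Z(t) >= - n ln theta.

    On the other hand the derivative can be computed from the generator.  A jump
    across an edge inside a cycle splits the cycle and multiplies the weight by
    theta; a jump across any other edge merges two cycles and divides the weight
    by theta.  If S is the number of edges inside cycles, then
      Z'(t) / Z(t) = (theta - 1/theta) E_theta,t(S) - (1 - 1/theta) n d / 2,
    see [interchange_slope].

    In a random regular graph, small sets of vertices span hardly more edges
    than a tree: with probability tending to 1, every set of at most eta n
    vertices contains at most (1 + 1/L) times as many edges as vertices.  So
    S <= (1 + 1/L) n in the absence of a cycle longer than eta n, and if such a
    cycle had weighted probability less than epsilon, the two estimates of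
    Z'(t) / Z(t) would give
      - ln theta
        <= t (1 - 1/theta) ((theta + 1) (1 + 1/L + epsilon d / 2) - d / 2),
    which fails for 1/L and epsilon small exactly because t > T(theta, d)
    ([slope_bound], [threshold_gap]).

    The sparsity of random regular graphs ([card_not_sparse]) is a union bound.
    The probability that m given edges inside a small set are all present is at
    most (2 d / n)^m; this is shown by switching one of these edges with a far
    away edge, one after the other ([switching], [card_regular_containing]).

    The transition function of the process is only known through its rates.
    These determine it ([tf_unique]), and this yields its invariance under
    translations and inversion, which the symmetry of the matrices above
    expresses. *)

(** * Markov jump processes on a finite set *)

Section markov.
Variables (R : realType) (S : finType).
Implicit Types (p : R -> S -> S -> R) (q : S -> S -> R).

Lemma cvg_div_succ (g : R -> R) (l t : R) : 0 < t ->
  g h @[h --> 0^'+] --> l -> g (t / n.+1%:R) @[n --> \oo] --> l.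
Proof.
move=> t0 /cvg_at_rightP; apply; split=> [n|]; first by rewrite divr_gt0.
rewrite -(mulr0 t); apply: cvgMr.
exact: cvg_harmonic.
Qed.

(** The weights [p h x y] sum to 1 over [y], so subtracting [phi x] cancels the
    diagonal term, about which the rates say nothing. *)
Lemma tf_generator p q (phi : S -> R) (x : S) :
  transition_function p ->
  (forall x y, x != y -> p h x y / h @[h --> 0^'+] --> q x y) ->
  (\sum_y p h x y * phi y - phi x) / h @[h --> 0^'+]
    --> \sum_(y | y != x) q x y * (phi y - phi x).
Proof.
move=> tp pq.
have : \sum_(y | y != x) (p h x y / h * (phi y - phi x)) @[h --> 0^'+]
    --> \sum_(y | y != x) q x y * (phi y - phi x).
  apply: cvg_big => //; first by apply: add_continuous.
  move=> y yx; apply: cvgMl.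
  by apply: pq; rewrite eq_sym.
apply: cvg_trans; apply: near_eq_cvg; near=> h.
have h0 : 0 <= h by apply: ltW; near: h; exact: nbhs_right_gt.
have -> : \sum_y p h x y * phi y - phi x =
          \sum_(y | y != x) p h x y * (phi y - phi x).
  rewrite -[X in _ - X]mul1r -(tf_sum1 tp x h0) mulr_suml -sumrB.
  rewrite (bigD1 x) //= subrr add0r.
  by apply: eq_bigr => y _; rewrite mulrBr.
by rewrite mulr_suml; apply: eq_bigr => y _; rewrite mulrAC.
Unshelve. all: by end_near.
Qed.

(** The rates determine the transition function.  Stochastic matrices do not
    increase the total variation, so the errors made in [n] consecutive steps of
    length [t / n] add up to at most [n] times the error of one step; the latter
    is o(t / n) because both one-step matrices have the same rates. *)
Lemma tf_unique p p' q : transition_function p -> transition_function p' ->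
  (forall x y, x != y -> p h x y / h @[h --> 0^'+] --> q x y) ->
  (forall x y, x != y -> p' h x y / h @[h --> 0^'+] --> q x y) ->
  forall t x y, 0 <= t -> p t x y = p' t x y.
Proof.
move=> tp tp' pq p'q t x y; rewrite le_eqVlt => /orP[/eqP <-|t0].
  by rewrite (tf_0 tp) (tf_0 tp').
pose row h x := \sum_z `|p h x z - p' h x z|.
pose tot h := \sum_x row h x.
(* The kernel up to time [a] is replaced first, then that of the last step. *)
have rowD a b u : 0 <= a -> 0 <= b -> row (a + b) u <= row a u + tot b.
  move=> a0 b0; rewrite /row.
  have -> : \sum_z `|p a u z - p' a u z| =
            \sum_z \sum_y `|p a u y - p' a u y| * p b y z.
    rewrite exchange_big /=; apply: eq_bigr => v _.
    by rewrite -mulr_sumr (tf_sum1 tp) // mulr1.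
  have : \sum_z \sum_y p' a u y * `|p b y z - p' b y z| <= tot b.
    rewrite exchange_big /=; apply: ler_sum => v _.
    rewrite -mulr_sumr ler_piMl ?sumr_ge0 // -(tf_sum1 tp' u a0).
    by rewrite (bigD1 v) //= lerDl sumr_ge0 // => w _; apply: (tf_ge0 tp').
  move=> le_tot; apply: le_trans (lerD (lexx _) le_tot).
  rewrite -big_split /=; apply: ler_sum => z _.
  rewrite (tf_chapman_kolmogorov tp) // (tf_chapman_kolmogorov tp') //.
  rewrite -sumrB -big_split /=; apply: le_trans (ler_norm_sum _ _ _) _.
  apply: ler_sum => v _.
  rewrite (_ : _ - _ = (p a u v - p' a u v) * p b v z
                       + p' a u v * (p b v z - p' b v z)); last by ring.
  apply: le_trans (ler_normD _ _) _.
  by rewrite !normrM (ger0_norm (tf_ge0 tp v z b0))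
    (ger0_norm (tf_ge0 tp' u v a0)).
have rowM n h u : 0 <= h -> row (n%:R * h) u <= n%:R * tot h.
  move=> h0; elim: n => [|n IHn].
    rewrite !mul0r /row big1 // => z _.
    by rewrite (tf_0 tp) (tf_0 tp') subrr normr0.
  rewrite -natr1 !mulrDl !mul1r.
  by apply: le_trans (rowD _ _ _ _ h0) _; rewrite ?mulr_ge0 ?lerD2r.
have dcvg u v : `|p h u v - p' h u v| / h @[h --> 0^'+] --> 0.
  have e0 : forall h, p h u v = \sum_w p h u w * (w == v)%:R.
    move=> h; rewrite (bigD1 v) //= eqxx mulr1 big1 ?addr0 // => w /negPf ->.
    by rewrite mulr0.
  have e0' : forall h, p' h u v = \sum_w p' h u w * (w == v)%:R.
    move=> h; rewrite (bigD1 v) //= eqxx mulr1 big1 ?addr0 // => w /negPf ->.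
    by rewrite mulr0.
  have g := @tf_generator p q (fun w => (w == v)%:R) u tp pq.
  have g' := @tf_generator p' q (fun w => (w == v)%:R) u tp' p'q.
  have G : `|(\sum_w p h u w * (w == v)%:R - (u == v)%:R) / h -
              (\sum_w p' h u w * (w == v)%:R - (u == v)%:R) / h|
           @[h --> 0^'+] --> `|\sum_(y | y != u) q u y *
      ((y == v)%:R - (u == v)%:R) - \sum_(y | y != u) q u y *
      ((y == v)%:R - (u == v)%:R)|.
    exact: cvg_norm (cvgB g g').
  rewrite subrr normr0 in G.
  apply: cvg_trans G; apply: near_eq_cvg; near=> h.
  have h0 : 0 < h by near: h; exact: nbhs_right_gt.
  rewrite /= e0 e0' -mulrBl normrM (gtr0_norm (x := h^-1)) ?invr_gt0 //.
  by congr (`| _ | * _); rewrite opprB addrA subrK.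
have totcvg : tot h / h @[h --> 0^'+] --> 0.
  have -> : (fun h => tot h / h) =
      (fun h => \sum_x \sum_z `|p h x z - p' h x z| / h).
    by apply/funext => h; rewrite /tot mulr_suml; apply: eq_bigr => u _;
       rewrite mulr_suml.
  have G u : \sum_z `|p h u z - p' h u z| / h @[h --> 0^'+] --> \sum_(z : S) 0.
    by apply: cvg_big => //; exact: add_continuous.
  rewrite big1_eq in G.
  have : \sum_u \sum_z `|p h u z - p' h u z| / h @[h --> 0^'+] -->
       \sum_(u : S) 0.
    by apply: cvg_big => //; exact: add_continuous.
  by rewrite big1_eq.
have rt0 : row t x <= 0.
  have c : t * (tot (t / n.+1%:R) / (t / n.+1%:R)) @[n --> \oo] --> t * 0.
    by apply: cvgMr; apply: (@cvg_div_succ (fun h => tot h / h)).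
  rewrite mulr0 in c.
  rewrite -(cvg_lim _ c) //; apply: limr_ge; first by apply/cvg_ex; exists 0.
  near=> n.
  have n0 : n.+1%:R != 0 :> R by rewrite pnatr_eq0.
  have -> : t * (tot (t / n.+1%:R) / (t / n.+1%:R)) =
            n.+1%:R * tot (t / n.+1%:R).
    by rewrite invf_div mulrCA [t * (_ * _)]mulrC divfK ?gt_eqF // mulrC.
  have := @rowM n.+1 (t / n.+1%:R) x.
  by rewrite [_ * (t / _)]mulrC divfK //; apply; rewrite divr_ge0 // ltW.
apply/eqP; rewrite -subr_eq0 -normr_le0; apply: le_trans rt0.
by rewrite /row (bigD1 y) //= lerDl sumr_ge0.
Unshelve. all: by end_near.
Qed.

End markov.

Section jump_process_law.
Variables (R : realType) (S : finType) (q : S -> S -> R) (x0 : S).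
Variables (d : measure_display) (Omega : measurableType d).
Variables (P : probability Omega R) (X : R -> Omega -> S).
Hypothesis mjpX : markov_jump_process q x0 P X.

(** The Markov property conditioned on the state at time 0, which is not
    random. *)
Lemma mjp_law : exists p, [/\ transition_function p,
  forall x y, x != y -> p h x y / h @[h --> 0^'+] --> q x y
  & forall t y, 0 <= t -> P (X t @^-1` [set y]) = (p t x0 y)%:E].
Proof.
have [p [tp pq mark]] := mjp_markov mjpX.
exists p; split => // t y t0.
have start : \bigcap_(i in [set i | (i <= 0)%N]) X 0 @^-1` [set x0] = setT.
  by apply/seteqP; split => // w _ i _; exact: mjp_start mjpX w.
have := mark 0%N (fun=> 0) (fun=> x0) t y (lexx 0) (fun _ _ _ => lexx 0) t0.
by rewrite /= add0r start setTI probability_setT mul1e.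
Qed.

Lemma mjp_expectation p t (g : S -> R) :
  (forall y, P (X t @^-1` [set y]) = (p t x0 y)%:E) -> 0 <= t ->
  (forall y, 0 <= g y) ->
  fine 'E_P[fun w => g (X t w)] = \sum_y p t x0 y * g y.
Proof.
move=> law t0 g0; rewrite unlock.
have mX y : measurable (X t @^-1` [set y]) := mjp_measurable mjpX y t0.
have gE w : (g (X t w))%:E =
    (\sum_y (g y)%:E * (\1_(X t @^-1` [set y]) w)%:E)%E.
  rewrite (bigD1 (X t w)) //= indicE mem_set // mule1 big1 ?adde0 // => y yX.
  by rewrite indicE memNset ?mule0 // => /esym e; rewrite e eqxx in yX.
under eq_integral => w _ do rewrite gE.
rewrite ge0_integral_sum //; last 2 first.
- move=> y; apply: measurable_funeM; apply/measurable_EFinP.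
  exact: measurable_indic.
- by move=> y w _; rewrite mule_ge0 // lee_fin.
rewrite (eq_bigr (fun y => (p t x0 y * g y)%:E)) => [|y _].
  by rewrite sumEFin.
rewrite ge0_integralZl //.
- rewrite integral_indic // setIT mulrC EFinM; congr (_ * _)%E; exact: law.
- by apply/measurable_EFinP; exact: measurable_indic.
- by rewrite lee_fin.
Qed.
End jump_process_law.

(** * Reversible random walks on a finite group *)

(** Lagrange's identity writes twice the difference of the two sides as a sum of
    squares. *)
Lemma sum_cauchy_schwarz (R : realType) (I : finType) (a b : I -> R) :
  (\sum_i a i * b i) ^+ 2 <= (\sum_i a i ^+ 2) * (\sum_i b i ^+ 2).
Proof.
suff : 0 <= \sum_i \sum_j (a i * b j - a j * b i) ^+ 2.
  have -> : \sum_i \sum_j (a i * b j - a j * b i) ^+ 2 =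
      \sum_i \sum_j (a i ^+ 2 * b j ^+ 2) + \sum_i \sum_j (b i ^+ 2 * a j ^+ 2)
      - 2 * \sum_i \sum_j (a i * b i * (a j * b j)).
    rewrite mulr_sumr -big_split -sumrB /=; apply: eq_bigr => i _.
    rewrite mulr_sumr -big_split -sumrB /=; apply: eq_bigr => j _.
    by ring.
  rewrite -!big_distrlr /=; lra.
by apply: sumr_ge0 => i _; apply: sumr_ge0 => j _; exact: sqr_ge0.
Qed.

(** Log-convexity makes the ratios [z j.+1 / z j] increase with [j], and
    [z n / z 0] is the product of the first [n] of them. *)
Lemma log_convex_ratio (R : realType) (z : nat -> R) :
  (forall j, 0 < z j) -> (forall j, z j.+1 ^+ 2 <= z j * z j.+2) ->
  forall n, z n / z 0%N <= (z n.+1 / z n) ^+ n.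
Proof.
move=> z0 zconv; pose r j := z j.+1 / z j.
have r0 j : 0 <= r j by rewrite divr_ge0 ?ltW.
have rle j : r j <= r j.+1.
  by rewrite /r ler_pdivrMr // mulrAC ler_pdivlMr // mulrC -expr2 mulrC.
suff le n : z n / z 0%N <= r n ^+ n by [].
elim: n => [|n IHn]; first by rewrite divff ?gt_eqF.
apply: le_trans (_ : r n ^+ n.+1 <= _); last by rewrite lerXn2r ?nnegrE.
rewrite exprSr (_ : _ / _ = z n / z 0%N * r n).
  exact: ler_wpM2r.
by rewrite /r; field; rewrite !gt_eqF.
Qed.

Section group_walk.
Variables (R : realType) (gT : finGroupType) (q : gT -> gT -> R).
Variable p : R -> gT -> gT -> R.
Hypothesis q_lmul : forall g a b, q (g * a)%g (g * b)%g = q a b.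
Hypothesis q_sym : forall a b, q a b = q b a.
Hypothesis tf_p : transition_function p.
Hypothesis p_rate : forall x y, x != y -> p h x y / h @[h --> 0^'+] --> q x y.

(** Translating a transition function by a group element preserves the rates,
    so uniqueness applies; likewise for transposition in [walk_sym].  There,
    translation invariance is what makes the columns sum to 1. *)
Lemma walk_lmul t g a b : 0 <= t -> p t (g * a)%g (g * b)%g = p t a b.
Proof.
apply: (@tf_unique _ _ (fun h a b => p h (g * a)%g (g * b)%g) p q) => // {t a b}.
- split.
  + by move=> h x y; exact: tf_ge0.
  + move=> h x h0; rewrite -[RHS](tf_sum1 tf_p (g * x)%g h0).
    by rewrite [RHS](reindex_inj (mulgI g)).
  + by move=> x y; rewrite (tf_0 tf_p) (inj_eq (mulgI g)).
  + move=> s h x z s0 h0; rewrite (tf_chapman_kolmogorov tf_p) //.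
    by rewrite (reindex_inj (mulgI g)).
- move=> x y xy; rewrite -(q_lmul g); apply: p_rate.
  by rewrite (inj_eq (mulgI g)).
Qed.

Lemma walk_sym t a b : 0 <= t -> p t a b = p t b a.
Proof.
apply: (@tf_unique _ _ p (fun h a b => p h b a) q) => // {t a b}.
- split.
  + by move=> h x y; exact: tf_ge0.
  + move=> h x h0; rewrite -[RHS](tf_sum1 tf_p 1%g h0).
    rewrite [RHS](reindex_inj (mulIg x)) [RHS](reindex_inj invg_inj) /=.
    by apply: eq_bigr => y _; rewrite -[RHS](walk_lmul y) // mulg1 mulKVg.
  + by move=> x y; rewrite (tf_0 tf_p) eq_sym.
  + move=> s h x z s0 h0; rewrite addrC (tf_chapman_kolmogorov tf_p) //.
    by apply: eq_bigr => y _; rewrite mulrC.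
- by move=> x y xy; rewrite q_sym; apply: p_rate; rewrite eq_sym.
Qed.

Lemma walk_inv t a : 0 <= t -> p t 1%g a^-1%g = p t 1%g a.
Proof. by move=> t0; rewrite -(walk_lmul a) // mulg1 mulgV walk_sym. Qed.

Variables (C : finType) (to : {action gT &-> C}).
Hypothesis fix_gt0 : forall a, (0 < #|'Fix_to[a]%g|)%N.

(** The trace of the mean, over the walk at time [t], of the permutation matrix
    by which a group element acts on [C]. *)
Definition fix_mean t : R := \sum_a p t 1%g a * #|'Fix_to[a]%g|%:R.

Let moves t c c' : R := \sum_a p t 1%g a * (to c a == c')%:R.

(** The mean permutation matrices [moves] form a semigroup and are symmetric,
    because a step and its inverse are equally likely.  The trace of a product
    of two symmetric matrices is the sum of the products of their entries. *)
Lemma fix_meanD s r : 0 <= s -> 0 <= r ->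
  fix_mean (s + r) = \sum_(x : C * C) moves s x.1 x.2 * moves r x.1 x.2.
Proof.
move=> s0 r0; rewrite /fix_mean.
have -> : \sum_(x : C * C) moves s x.1 x.2 * moves r x.1 x.2 =
    \sum_a \sum_b p s 1%g a * p r 1%g b * \sum_c (to c a == to c b)%:R.
  rewrite -(pair_big xpredT xpredT (fun c c' => moves s c c' * moves r c c')) /=.
  rewrite /moves.
  under eq_bigr => c _ do under eq_bigr => c' _ do rewrite big_distrlr /=.
  under eq_bigr => c _ do rewrite exchange_big /=.
  rewrite exchange_big /=; apply: eq_bigr => a _.
  under eq_bigr => c _ do rewrite exchange_big /=.
  rewrite exchange_big /=; apply: eq_bigr => b _.
  rewrite mulr_sumr; apply: eq_bigr => c _.
  rewrite (bigD1 (to c b)) //= eqxx mulr1 big1 ?addr0; first by ring.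
  by move=> c' /negPf cb; rewrite [to c b == _]eq_sym cb !mulr0.
under eq_bigr => g _.
  rewrite (tf_chapman_kolmogorov tf_p) // mulr_suml; over.
rewrite exchange_big /=; apply: eq_bigr => a _.
rewrite (reindex_inj (mulgI a)) (reindex_inj invg_inj) /=.
apply: eq_bigr => b _.
rewrite -{2}[a]mulg1 walk_lmul // walk_inv //; congr (_ * _).
rewrite -sum1_card natr_sum big_mkcond /=; apply: eq_bigr => c _.
have -> : (c \in 'Fix_to[a * b^-1]%g) = (to c a == to c b).
  apply/afix1P/eqP; rewrite actM; last by move->; rewrite actK.
  by move=> {2}<-; rewrite actKV.
by case: eqP.
Qed.

Lemma fix_mean_log_convex s r : 0 <= s -> 0 <= r ->
  fix_mean (s + r) ^+ 2 <= fix_mean (s + s) * fix_mean (r + r).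
Proof.
move=> s0 r0; rewrite !fix_meanD //.
by have := sum_cauchy_schwarz (fun x => moves s x.1 x.2)
                             (fun x => moves r x.1 x.2).
Qed.

Lemma fix_mean_ge1 t : 0 <= t -> 1 <= fix_mean t.
Proof.
move=> t0; rewrite -(tf_sum1 tf_p 1%g t0); apply: ler_sum => a _.
by rewrite ler_peMr ?(tf_ge0 tf_p) // ler1n.
Qed.

Lemma fix_mean0 : fix_mean 0 = #|C|%:R.
Proof.
rewrite /fix_mean (bigD1 1%g) //= (tf_0 tf_p) eqxx mul1r big1 ?addr0.
  by congr _%:R; apply: eq_card => c; rewrite [RHS]inE; apply/afix1P; exact: act1.
by move=> a; rewrite eq_sym (tf_0 tf_p) => /negPf ->; rewrite mul0r.
Qed.

Definition fix_slope (a : gT) : R :=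
  \sum_(b | b != a) q a b * (#|'Fix_to[b]%g|%:R - #|'Fix_to[a]%g|%:R).

Lemma fix_mean_derivative t : 0 <= t ->
  (fix_mean (t + h) - fix_mean t) / h @[h --> 0^'+]
    --> \sum_a p t 1%g a * fix_slope a.
Proof.
move=> t0.
have G : \sum_a (p t 1%g a * ((\sum_b p h a b * #|'Fix_to[b]%g|%:R
            - #|'Fix_to[a]%g|%:R) / h)) @[h --> 0^'+]
    --> \sum_a p t 1%g a * fix_slope a.
  apply: cvg_big => //; first by apply: add_continuous.
  move=> a _; apply: cvgMr.
  exact: (@tf_generator _ _ p q (fun b => #|'Fix_to[b]%g|%:R)).
apply: cvg_trans G; apply: near_eq_cvg; near=> h.
have h0 : 0 <= h by apply: ltW; near: h; exact: nbhs_right_gt.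
under eq_bigr => a _ do rewrite mulrA.
rewrite -mulr_suml; congr (_ / _).
under eq_bigr => a _ do rewrite mulrBr.
rewrite sumrB; congr (_ - _).
under eq_bigr => a _ do rewrite mulr_sumr.
rewrite exchange_big /=; apply: eq_bigr => b _.
rewrite (tf_chapman_kolmogorov tf_p) // mulr_suml.
by apply: eq_bigr => a _; rewrite mulrA.
Unshelve. all: by end_near.
Qed.

(** A log-convex function has at [t] at least the logarithmic slope of its chord
    over [0, t].  The chord starts at [ln #|C|] and ends at a nonnegative value,
    whence the lower bound [- ln #|C| / t]. *)
Lemma fix_mean_slope t : 0 < t ->
  - ln #|C|%:R <= t * ((\sum_a p t 1%g a * fix_slope a) / fix_mean t).
Proof.
move=> t0; set D := \sum_a _.
have Zt0 s : 0 <= s -> 0 < fix_mean s.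
  by move=> s0; apply: lt_le_trans (fix_mean_ge1 s0).
have der : t * ((fix_mean (t + t / n.+1%:R) - fix_mean t) / (t / n.+1%:R)
              / fix_mean t) @[n --> \oo] --> t * (D / fix_mean t).
  apply: cvgMr; apply: cvgMl.
  apply: (@cvg_div_succ _ (fun h => (fix_mean (t + h) - fix_mean t) / h)) => //.
  by apply: fix_mean_derivative; exact: ltW.
rewrite -(cvg_lim _ der) //; apply: limr_ge.
  by apply/cvg_ex; exists (t * (D / fix_mean t)).
near=> n.
(* Midpoint log-convexity is only used on the grid of mesh [h] on which [t] is
   the point of index [n.+1], so that no continuity is needed. *)
pose h := t / n.+1%:R.
have h0 : 0 < h by rewrite divr_gt0.
have tE : n.+1%:R * h = t by rewrite mulrC divfK.
pose z j := fix_mean (j%:R * h).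
have zgt0 j : 0 < z j by apply: Zt0; rewrite mulr_ge0 // ltW.
have zconv j : z j.+1 ^+ 2 <= z j * z j.+2.
  have := @fix_mean_log_convex (j%:R * h / 2) (j.+2%:R * h / 2).
  rewrite /z -!splitr -mulrDl -mulrDl -natrD.
  have -> : (j + j.+2 = j.+1 * 2)%N by lia.
  rewrite natrM [_ * 2 * h]mulrAC mulfK ?pnatr_eq0 //; apply.
    by rewrite !mulr_ge0 ?invr_ge0 // ltW.
  by rewrite !mulr_ge0 ?invr_ge0 // ltW.
have := log_convex_ratio zgt0 zconv n.+1.
rewrite /z mul0r tE fix_mean0 -natr1 mulrDl tE mul1r => ratio.
set x := _ / fix_mean t in ratio.
have C0 : 0 < #|C|%:R :> R by rewrite -fix_mean0 Zt0.
have x0 : 0 < x by rewrite divr_gt0 // Zt0 // ?addr_ge0 // ltW.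
have lnx : - ln #|C|%:R <= n.+1%:R * ln x.
  rewrite -lnV ?posrE // mulr_natl -lnXn // ler_ln ?posrE ?invr_gt0 ?exprn_gt0 //.
  apply: le_trans ratio; rewrite ler_peMl ?invr_ge0 //.
  exact/fix_mean_ge1/ltW.
apply: le_trans lnx _.
have -> : t * ((fix_mean (t + h) - fix_mean t) / h / fix_mean t) =
    n.+1%:R * (x - 1).
  rewrite /x -{1}tE; field.
  by rewrite !gt_eqF // Zt0 // ltW.
rewrite ler_wpM2l //.
(* The logarithm is below its tangent at 1, which turns the discrete ratio
   into a difference quotient. *)
have := expR_ge1Dx (ln x); rewrite lnK ?posrE //; lra.
Unshelve. all: by end_near.
Qed.
End group_walk.

(** * Cycles of a permutation and colourings of its domain *)

Section interchange_cycles.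
Variable V : finType.
Implicit Types (a : {perm V}) (e : {set V}).

Lemma porbits_partition a : finset.partition (porbits a) [set: V]%SET.
Proof.
have -> : porbits a = orbit 'P <[a]> @: [set: V]%SET.
  apply/setP => O; apply/imsetP/imsetP => -[x _ ->]; exists x; rewrite ?inE //.
    by rewrite porbitE.
  by rewrite porbitE.
apply: orbit_partition; apply/actsP => b _ x; by rewrite !inE.
Qed.

(** The inverse makes this a right action: the product of permutations composes
    from left to right. *)
Definition perm_colour (k : nat) (c : {ffun V -> 'I_k}) a : {ffun V -> 'I_k} :=
  [ffun v => c (a^-1%g v)].

Lemma perm_colour1 k : @perm_colour k^~ 1%g =1 id.
Proof. by move=> c; apply/ffunP => v; rewrite ffunE invg1 perm1. Qed.

Lemma perm_colourM k c : act_morph (@perm_colour k) c.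
Proof. by move=> a b; apply/ffunP => v; rewrite !ffunE invMg permM. Qed.

Definition colour_action k := TotalAction (@perm_colour1 k) (@perm_colourM k).

Local Notation fixed_colours k a := (afix (colour_action k) [set a]%SET).

(** A colouring is fixed exactly if it is constant on every cycle, so it amounts
    to one colour per cycle.  Such a choice is encoded as a function on all sets
    of points which has the default colour outside the set of cycles. *)
Lemma card_fix_colour k a :
  (0 < k)%N -> #|fixed_colours k a| = (k ^ ncycles a)%N.
Proof.
case: k => // k _.
rewrite -[k.+1 in RHS]card_ord -(card_pffun_on ord0 (porbits a) predT).
pose F (g : {ffun {set V} -> 'I_k.+1}) := [ffun v => g (porbit a v)].
have fixP c : c \in (fixed_colours k.+1 a) <-> forall v, c (a v) = c v.
  split=> [/afix1P ca v|ca].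
    by rewrite -[in LHS]ca /= ffunE permK.
  apply/afix1P; apply/ffunP => v; rewrite ffunE.
  by rewrite -{2}[v](permKV a) ca.
rewrite -(card_in_imset (f := F)); last first.
  move=> g g' /pffun_onP[/fintype.subsetP sg _] /pffun_onP[/fintype.subsetP sg' _].
  move=> /ffunP eqF; apply/ffunP => O.
  have [/imsetP[v _ ->]|ON] := boolP (O \in porbits a).
    by have := eqF v; rewrite !ffunE.
  have z h : {subset ord0.-support h <= porbits a} -> h O = ord0.
    by move=> sh; apply/eqP; apply: contraNT ON => hO; exact: sh.
  by rewrite !z.
apply: eq_card => c; apply/idP/imsetP => [/fixP ca|[g _ ->]]; last first.
  by apply/fixP => v; rewrite !ffunE; congr (g _); apply/eqP;
    rewrite eq_porbit_mem -{1}[a]expg1 mem_porbit.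
have cO v w : w \in porbit a v -> c w = c v.
  case/porbitP => i ->; elim: i => [|i IHi]; first by rewrite perm1.
  by rewrite expgSr permM ca.
exists [ffun O : {set V} => if O \in porbits a
        then (if [pick v in O] is Some v then c v else ord0) else ord0].
  apply/pffun_onP; split=> //; apply/fintype.subsetP => O; rewrite inE ffunE.
  by case: ifP => //; rewrite eqxx.
apply/ffunP => v; rewrite !ffunE imset_f //.
case: pickP => [w /cO -> //|/(_ v)]; by rewrite porbit_id.
Qed.

Definition inside_cycle a e := [exists x, e \subset porbit a x].

Lemma inside_cycle_pair a x y :
  inside_cycle a [set x; y]%SET = (x \in porbit a y).
Proof.
apply/existsP/idP => [[z /fintype.subsetP s]|xy].
  have := s x (set21 _ _); have := s y (set22 _ _).
  by rewrite -!eq_porbit_mem => /eqP -> /eqP ->.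
exists y; apply/fintype.subsetP => z; rewrite in_set2.
by case/orP => /eqP -> //; exact: porbit_id.
Qed.

(** A transposition splits the cycle that contains both its points, or merges
    the two cycles that contain them.  Inversion turns the product on the right
    into one on the left. *)
Lemma ncycles_mul_tperm a x y : x != y ->
  (ncycles (a * tperm x y) + (x \notin porbit a y).*2 = ncycles a + 1)%N.
Proof.
move=> xy; rewrite /ncycles -porbitsV invMg tpermV.
by have := porbits_mul_tperm a^-1%g x y; rewrite /= xy porbitsV porbitV.
Qed.

Lemma edge_pair (G : sgraph V) e : e \in edges G ->
  exists x y, x != y /\ e = [set x; y]%SET.
Proof.
move=> eG; have /forallP/(_ e) := edges_card2 G; rewrite eG /=.
by case/cards2P => x [y [xy ->]]; exists x, y.
Qed.

Variable R : realType.

Lemma rate_lmul (G : sgraph V) g a b :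
  interchange_rate R G (g * a)%g (g * b)%g = interchange_rate R G a b.
Proof.
rewrite /interchange_rate; congr _%:R; apply: eq_card => e.
by rewrite !inE -mulgA (inj_eq (mulgI g)).
Qed.

Lemma edge_tperm_invol e : (edge_tperm e * edge_tperm e = 1)%g.
Proof.
rewrite /edge_tperm; case: pickP => [p _|_]; last by rewrite mulg1.
by rewrite tperm2.
Qed.

Lemma rate_sym (G : sgraph V) a b :
  interchange_rate R G a b = interchange_rate R G b a.
Proof.
rewrite /interchange_rate; congr _%:R; apply: eq_card => e.
rewrite !inE; congr (_ && _); apply/eqP/eqP => ->;
  by rewrite -mulgA edge_tperm_invol mulg1.
Qed.

(** An edge inside a cycle splits it and multiplies the weight by [k]; any other
    edge merges two cycles and divides the weight by [k]. *)
Lemma interchange_slope (G : sgraph V) k a : (0 < k)%N ->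
  fix_slope (interchange_rate R G) (colour_action k) a =
  k%:R ^+ ncycles a *
    ((k%:R - k%:R^-1) * #|[set e in edges G | inside_cycle a e]%SET|%:R
     - (1 - k%:R^-1) * #|edges G|%:R).
Proof.
move=> k0; rewrite /fix_slope.
pose chi (b : {perm V}) : R := k%:R ^+ ncycles b.
have fixE b : #|fixed_colours k b|%:R = chi b.
  by rewrite card_fix_colour // natrX.
have -> : \sum_(b | b != a) interchange_rate R G a b *
    (#|fixed_colours k b|%:R - #|fixed_colours k a|%:R) =
    \sum_(e in edges G) (chi (a * edge_tperm e)%g - chi a).
  under eq_bigr => b _ do rewrite !fixE.
  rewrite [LHS]big_mkcond /=.
  transitivity (\sum_b \sum_(e in edges G | b == (a * edge_tperm e)%g)
     (chi b - chi a)).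
    apply: eq_bigr => b _; rewrite sumr_const /interchange_rate.
    have [->|_] /= := eqVneq b a; first by rewrite subrr mul0rn.
    by rewrite mulr_natl; congr (_ *+ _); apply: eq_card => e; rewrite !inE.
  rewrite (exchange_big_dep (mem (edges G))) //= => [|b e _ /andP[]//].
  apply: eq_bigr => e eG; rewrite (eq_bigl (pred1 (a * edge_tperm e)%g)).
    by rewrite big_pred1_eq.
  by move=> b; rewrite eG.
have kk : k%:R != 0 :> R by rewrite pnatr_eq0 -lt0n.
have step e : e \in edges G -> chi (a * edge_tperm e)%g - chi a =
    chi a * ((k%:R - k%:R^-1) * (inside_cycle a e)%:R - (1 - k%:R^-1)).
  move=> /edge_pair[x [y [xy ->]]]; rewrite edge_tpermE inside_cycle_pair /chi.
  have := ncycles_mul_tperm a xy; case: (x \in porbit a y) => /=.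
    rewrite addn0 addn1 => ->; rewrite exprS.
    by move: (k%:R : R) kk => c _; move: (c ^+ _) (c^-1) => u i; ring.
  move=> h; have {h} -> : ncycles a = (ncycles (a * tperm x y)).+1.
    by move: h; move: (ncycles _) (ncycles _) => n1 n2; lia.
  rewrite exprS mulr0.
  move: (k%:R : R) kk => c c0; move: (c ^+ _) => u.
  by rewrite sub0r mulrN mulrBr mulr1 opprB mulrAC divff // mul1r.
rewrite (eq_bigr _ step) -mulr_sumr sumrB -mulr_sumr sumr_const.
congr (_ * (_ * _ - _)).
  rewrite -sum1_card natr_sum [RHS]big_mkcond [LHS]big_mkcond /=.
  apply: eq_bigr => e _; rewrite inE; case: (e \in edges G) => //=.
  by case: (inside_cycle a e).
by rewrite mulr_natr.
Qed.

End interchange_cycles.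

(** * Edges of a random regular graph inside a small set *)

Section edge_sets.
Variable V : finType.
Implicit Types (E F : {set {set V}}) (S : {set V}) (x y u v w : V).

(** Graphs are handled through their edge sets, which can be modified freely
    before one knows that the result is again a graph. *)
Definition edge_set_regular d E : bool :=
  [forall e in E, #|e| == 2%N] && [forall w, #|[set e in E | w \in e]%SET| == d].

Definition neighbours E x : {set V} := [set y | [set x; y]%SET \in E]%SET.

Lemma edge_neq d E x y :
  edge_set_regular d E -> [set x; y]%SET \in E -> x != y.
Proof.
move=> /andP[/forallP/(_ [set x; y]%SET) /implyP E2 _] /E2.
by rewrite cards2; case: (x != y).
Qed.

Lemma card_incident E x : [forall e in E, #|e| == 2%N] ->
  #|[set e in E | x \in e]%SET| = #|neighbours E x|.
Proof.
move=> /forallP E2.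
have -> : [set e in E | x \in e]%SET =
          (fun y => [set x; y]%SET) @: neighbours E x.
  apply/setP => e; rewrite inE; apply/andP/imsetP => [[eE xe]|[y + ->]].
    have := E2 e; rewrite eE /= => /cards2P[a [b [ab eab]]].
    move: xe; rewrite eab !inE => /orP[] /eqP xab.
      by exists b; rewrite ?inE xab // -eab.
    by exists a; rewrite ?inE xab finset.setUC // -eab.
  by rewrite inE => yE; rewrite set21.
rewrite card_in_imset // => y z; rewrite !inE => yE zE eqyz.
have := set22 x y; rewrite eqyz in_set2 => /orP[/eqP yx|/eqP //].
by have := E2 [set x; y]%SET; rewrite yE yx finset.setUid cards1.
Qed.

Lemma card_neighbours d E x : edge_set_regular d E -> #|neighbours E x| = d.
Proof. by move=> /andP[E2 /forallP/(_ x)/eqP <-]; rewrite card_incident. Qed.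

Lemma card_arcs_from d E (B : {set V}) : edge_set_regular d E ->
  #|[set p : V * V | ([set p.1; p.2]%SET \in E) && (p.1 \in B)]%SET|
    = (#|B| * d)%N.
Proof.
move=> Ereg; rewrite -sum1dep_card.
rewrite (eq_bigl (fun p => (p.1 \in B) && (p.2 \in neighbours E p.1))); last first.
  by move=> p; rewrite /= [p.2 \in _]inE andbC.
rewrite -(pair_big_dep (mem B) (fun x y => y \in neighbours E x) (fun _ _ => 1%N)) /=.
under eq_bigr => x _ do rewrite sum1_card (card_neighbours _ Ereg).
by rewrite sum_nat_const.
Qed.

Lemma card_arcs_to d E (B : {set V}) : edge_set_regular d E ->
  #|[set p : V * V | ([set p.1; p.2]%SET \in E) && (p.2 \in B)]%SET|
    = (#|B| * d)%N.
Proof.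
move=> Ereg; rewrite -(card_arcs_from B Ereg).
have sw_inj : injective (fun p : V * V => (p.2, p.1)).
  by move=> [a b] [a' b'] [-> ->].
rewrite -(card_imset _ sw_inj); apply: eq_card => p.
apply/imsetP/idP => [[q + ->]|]; first by rewrite !inE /= finset.setUC.
by case: p => a b; rewrite inE => /= pE; exists (b, a);
  rewrite // inE /= finset.setUC.
Qed.

(** The edges xy and uv are exchanged for xu and yv, which keeps all the
    degrees. *)
Definition switch E x y u v : {set {set V}} :=
  ([set x; u] |: ([set y; v] |: (E :\ [set x; y] :\ [set u; v])))%SET.

(** Switching back exchanges the roles of [y] and [u]. *)
Lemma switchK E x y u v :
  [set x; y]%SET \in E -> [set u; v]%SET \in E ->
  [set x; u]%SET \notin E -> [set y; v]%SET \notin E ->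
  switch (switch E x y u v) x u y v = E.
Proof.
move=> xyE uvE xuE yvE; apply/setP => e; rewrite /switch !inE.
have [->|exy] := eqVneq e [set x; y]%SET; first by rewrite xyE.
have [->|euv] := eqVneq e [set u; v]%SET; first by rewrite uvE.
have [->|exu] := eqVneq e [set x; u]%SET.
  by rewrite (negPf xuE) !andbF.
by have [->|eyv] := eqVneq e [set y; v]%SET; rewrite // (negPf yvE).
Qed.

Lemma switch_regular d E x y u v : edge_set_regular d E ->
  x != u -> y != v -> x != v ->
  [set x; y]%SET \in E -> [set u; v]%SET \in E ->
  [set x; u]%SET \notin E -> [set y; v]%SET \notin E ->
  edge_set_regular d (switch E x y u v).
Proof.
move=> Ereg xu yv xv xyE uvE xuE yvE; have /andP[/forallP E2 /forallP Ed] := Ereg.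
have xy := edge_neq Ereg xyE; have uv := edge_neq Ereg uvE.
apply/andP; split.
  apply/forallP => e; apply/implyP; rewrite !inE.
  case/or3P => [/eqP->|/eqP->|/and3P[_ _ eE]]; rewrite ?cards2 ?xu ?yv //.
  by have := E2 e; rewrite eE.
apply/forallP => w; rewrite -(eqP (Ed w)).
have degE F : #|[set e in F | w \in e]%SET| = (\sum_(e in F) (w \in e))%N.
  rewrite -sum1_card big_mkcond [RHS]big_mkcond /=; apply: eq_bigr => e _.
  by rewrite inE; case: (e \in F) => //=; case: (w \in e).
have in2 a b : a != b -> (w \in [set a; b]%SET : nat) = ((w == a) + (w == b))%N.
  rewrite in_set2; have [->|_] := eqVneq w a => //.
  by move/negPf ->.
have uvxy : [set u; v]%SET != [set x; y]%SET.
  apply/eqP => e; have := set21 x y; rewrite -e in_set2.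
  by rewrite (negPf xu) (negPf xv).
have xuyv : [set x; u]%SET != [set y; v]%SET.
  apply/eqP => e; have := set21 x u; rewrite e in_set2.
  by rewrite (negPf xy) (negPf xv).
rewrite !degE; apply/eqP.
rewrite [in RHS](big_setD1 [set x; y]%SET) //=.
rewrite [in RHS](big_setD1 [set u; v]%SET) /=; last by rewrite !inE uvxy.
rewrite [in LHS](big_setD1 [set x; u]%SET) /=; last by rewrite !inE eqxx.
rewrite finset.setU1K; last by rewrite !inE (negPf xuyv) (negPf xuE) !andbF.
rewrite [in LHS](big_setD1 [set y; v]%SET) /=; last by rewrite !inE eqxx.
rewrite finset.setU1K; last by rewrite !inE (negPf yvE) !andbF.
by rewrite !in2 // !addnA; congr (_ + _ + _)%N; rewrite addnAC.
Qed.

Definition regular_containing d F : {set {set {set V}}} :=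
  [set E | edge_set_regular d E & F \subset E]%SET.

Definition regular_edge_sets d : {set {set {set V}}} :=
  [set E | edge_set_regular d E]%SET.

(** Double counting of the switchings that destroy the edge xy.  A regular graph
    that contains [F] has [#|V| * d] oriented edges uv.  Those with [u] outside
    [S] and not adjacent to [x], and [v] neither equal nor adjacent to [y], can
    be switched with xy without loss of the rest of [F], which lies inside [S].
    Conversely, a graph arises at most [d * d] times, since [u] and [v] have to
    be chosen among the neighbours of [x] and [y]. *)
Lemma switching d F S x y :
  {in F, forall e : {set V}, e \subset S} -> [set x; y]%SET \in F ->
  (#|regular_containing d F| * (#|V| - (#|S| + 2 * d + 1))
   <= d * #|regular_containing d (F :\ [set x; y]%SET)|)%N.
Proof.
move=> FS xyF.
have /fintype.subsetP xyS := FS _ xyF.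
have [d0|dgt0] := posnP d.
  rewrite [#|regular_containing _ F|](_ : _ = 0%N) //; apply: eq_card0 => E.
  rewrite inE; apply/negP => /andP[Ereg /fintype.subsetP/(_ _ xyF) xyE].
  have /eqP := card_neighbours x Ereg; rewrite d0 cards_eq0 => /eqP/setP/(_ y).
  by rewrite !inE xyE.
rewrite -(leq_pmul2l dgt0) mulnCA.
pose far E (p : V * V) := [&& [set p.1; p.2]%SET \in E,
  p.1 \notin (S :|: neighbours E x)%SET & p.2 \notin (y |: neighbours E y)%SET].
pose P := [set q : {set {set V}} * (V * V) |
   (q.1 \in regular_containing d F) && far q.1 q.2]%SET.
pose Q := [set q : {set {set V}} * (V * V) |
   [&& q.1 \in regular_containing d (F :\ [set x; y]%SET),
       q.2.1 \in neighbours q.1 x & q.2.2 \in neighbours q.1 y]]%SET.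
have cardP : (#|regular_containing d F| * (d * (#|V| - (#|S| + 2 * d + 1)))
              <= #|P|)%N.
  rewrite -[X in (_ <= X)%N]sum1dep_card -sum_nat_const.
  rewrite -(pair_big_dep (mem (regular_containing d F)) far (fun _ _ => 1%N)) /=.
  apply: leq_sum => E; rewrite inE => /andP[Ereg _].
  rewrite sum1dep_card mulnBr leq_subLR.
  have := card_arcs_from [set: V]%SET Ereg; rewrite cardsT mulnC => <-.
  have -> : (d * (#|S| + 2 * d + 1) =
    (#|S| + #|neighbours E x|) * d + (1 + #|neighbours E y|) * d)%N.
    by rewrite !(card_neighbours _ Ereg); lia.
  have le1 : ((#|S| + #|neighbours E x|) * d >=
     #|[set p : V * V | ([set p.1; p.2]%SET \in E) &&
           (p.1 \in (S :|: neighbours E x)%SET)]%SET|)%N.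
    rewrite (card_arcs_from _ Ereg) leq_pmul2r // cardsU; exact: leq_subr.
  have le2 : ((1 + #|neighbours E y|) * d >=
     #|[set p : V * V | ([set p.1; p.2]%SET \in E) &&
           (p.2 \in (y |: neighbours E y)%SET)]%SET|)%N.
    by rewrite (card_arcs_to _ Ereg) leq_pmul2r // cardsU1 leq_add2r leq_b1.
  apply: leq_trans (leq_add (leq_add le1 le2) (leqnn _)).
  apply: leq_trans (leq_trans (leq_add (leq_card_setU _ _) (leqnn _)) _); last first.
    by [].
  apply: leq_trans (leq_card_setU _ _).
  apply: subset_leq_card; apply/fintype.subsetP => p; rewrite !inE andbT => pE.
  rewrite /far pE /=; rewrite !inE.
  by do ![case: (_ \in _) | case: (_ == _)].
have cardQ : (#|Q| <= d * (d * #|regular_containing d (F :\ [set x; y]%SET)|))%N.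
  rewrite -sum1dep_card.
  rewrite -(pair_big_dep (mem (regular_containing d (F :\ [set x; y]%SET)))
     (fun E p => (p.1 \in neighbours E x) && (p.2 \in neighbours E y))
     (fun _ _ => 1%N)) /=.
  rewrite mulnA mulnC -sum_nat_const; apply: leq_sum => E.
  rewrite inE => /andP[Ereg _].
  rewrite -{1}(card_neighbours x Ereg) -(card_neighbours y Ereg) -cardsX.
  rewrite sum1dep_card; apply: subset_leq_card; apply/fintype.subsetP => p.
  by rewrite !inE.
apply: leq_trans cardP _; apply: leq_trans cardQ.
pose f (q : {set {set V}} * (V * V)) := (switch q.1 x y q.2.1 q.2.2, q.2).
have PP q : q \in P ->
  [/\ edge_set_regular d q.1, {subset F <= q.1} , [set q.2.1; q.2.2]%SET \in q.1,
      q.2.1 \notin S /\ [set x; q.2.1]%SET \notin q.1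
    & q.2.2 != y /\ [set y; q.2.2]%SET \notin q.1].
  rewrite !inE => /andP[/andP[-> /fintype.subsetP FE]].
  by rewrite /far !inE !negb_or => /and3P[-> /andP[-> ->] /andP[-> ->]]; split.
rewrite -(card_in_imset (f := f) (D := P)); last first.
  move=> q q' /PP[_ FE uvE [_ xu] [_ yv]] /PP[_ FE' uvE' [_ xu'] [_ yv']] [eqs eqp].
  case: q FE uvE xu yv eqs eqp => E [u v] /= FE uvE xu yv eqs eqp.
  case: q' FE' uvE' xu' yv' eqs eqp => E' p' /= FE' uvE' xu' yv' eqs eqp; subst p'.
  congr (_, _); rewrite -(switchK (FE _ xyF) uvE xu yv) eqs /=.
  by rewrite switchK // FE'.
apply: subset_leq_card; apply/fintype.subsetP => r /imsetP[[E [u v]] /PP[]].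
move=> /= Ereg FE uvE [uS xuE] [vy yvE] -> {r}; rewrite inE /=.
have xS := xyS _ (set21 x y); have yS := xyS _ (set22 x y).
have xu : x != u by apply: contraNneq uS => <-.
have xv : x != v.
  by apply: contraNneq yvE => <-; rewrite finset.setUC FE.
apply/and3P; split; last 2 first.
- by rewrite !inE eqxx.
- by rewrite !inE eqxx orbT.
rewrite inE switch_regular //; [|by rewrite eq_sym|exact: FE].
apply/fintype.subsetP => e; rewrite !inE => /andP[exy eF].
rewrite exy FE // andbT (_ : e != _) ?orbT //.
apply: contraNneq uS => euv; have /fintype.subsetP := FS _ eF.
by apply; rewrite euv set21.
Qed.

End edge_sets.

Lemma leq_card_bigcup (T I : finType) (A : {set I}) (F : I -> {set T}) :
  (#|(\bigcup_(i in A) F i)%SET| <= \sum_(i in A) #|F i|)%N.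
Proof.
elim/big_rec2: _ => [|i m U _ le_m]; first by rewrite cards0.
by apply: leq_trans (leq_card_setU _ _) _; rewrite leq_add2l.
Qed.

Section union_bound.
Variables (V : finType) (d : nat).
Implicit Types (E F : {set {set V}}) (S : {set V}).

(** For the uniform measure: all of [F] is present with probability at most
    [(2 * d / #|V|) ^ #|F|].  The edges of [F] are removed one at a time. *)
Lemma card_regular_containing F S :
  {in F, forall e : {set V}, e \subset S /\ #|e| = 2%N} ->
  (#|V| <= 2 * (#|V| - (#|S| + 2 * d + 1)))%N ->
  (#|regular_containing d F| * #|V| ^ #|F|
     <= (2 * d) ^ #|F| * #|regular_edge_sets V d|)%N.
Proof.
move=> FS small; have [m] := ubnP #|F|; elim: m F FS => // m IHm F FS.
have [->|[e eF]] := finset.set_0Vmem F.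
  rewrite cards0 !expn0 muln1 mul1n => _; apply: subset_leq_card.
  by apply/fintype.subsetP => E; rewrite !inE => /andP[].
rewrite (cardsD1 e) eF add1n ltnS => ltm.
have [_ /eqP/cards2P[x [y [_ exy]]]] := FS _ eF.
rewrite exy in eF ltm *.
have IH := IHm (F :\ [set x; y]%SET) _ ltm.
rewrite !expnS.
have sw : (#|regular_containing d F| * #|V|
    <= 2 * d * #|regular_containing d (F :\ [set x; y]%SET)|)%N.
  apply: leq_trans (leq_mul (leqnn _) small) _.
  rewrite mulnCA -mulnA leq_pmul2l //.
  by apply: switching => // f /FS[].
rewrite mulnA; apply: leq_trans (leq_mul sw (leqnn _)) _.
rewrite -!mulnA !leq_mul2l; apply/orP; right; apply/orP; right.
by apply: IH => f; rewrite !inE => /andP[_ /FS].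
Qed.

Definition has_dense_set k m : {set {set {set V}}} :=
  [set E | edge_set_regular d E &
    [exists S : {set V}, (#|S| == k) && (m <= #|[set e in E | e \subset S]|)%N]]%SET.

(** Union bound over the sets of [k] vertices and over [m] of the pairs inside
    each. *)
Lemma card_has_dense_set k m :
  (#|V| <= 2 * (#|V| - (k + 2 * d + 1)))%N ->
  (#|has_dense_set k m| * #|V| ^ m <=
     'C(#|V|, k) * 'C('C(k, 2), m) * (2 * d) ^ m
      * #|regular_edge_sets V d|)%N.
Proof.
move=> small.
pose pairs S := [set e : {set V} | e \subset S & #|e| == 2%N]%SET.
pose Fs S := [set F : {set {set V}} | F \subset pairs S & #|F| == m]%SET.
have sub : has_dense_set k m \subset
    (\bigcup_(S in [set S : {set V} | #|S| == k])
      \bigcup_(F in Fs S) regular_containing d F)%SET.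
  apply/fintype.subsetP => E; rewrite inE => /andP[Ereg /existsP[S /andP[Sk]]].
  case/card_geqP => s [us sm sE].
  apply/finset.bigcupP; exists S; first by rewrite inE.
  apply/finset.bigcupP; exists [set e in s]%SET.
    rewrite inE; apply/andP; split.
      apply/fintype.subsetP => e; rewrite inE => /sE; rewrite !inE => /andP[eE ->] /=.
      by case/andP: Ereg => /forallP/(_ e); rewrite eE.
    by rewrite cardsE (card_uniqP us) sm.
  rewrite inE Ereg /=; apply/fintype.subsetP => e; rewrite inE => /sE.
  by rewrite inE => /andP[].
have le_sum := leq_trans (subset_leq_card sub) (leq_card_bigcup _ _).
apply: leq_trans (leq_mul le_sum (leqnn _)) _.
rewrite -!mulnA -(card_draws V k) -sum_nat_const big_distrl /=.
apply: leq_sum => S; rewrite inE => /eqP Sk.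
apply: leq_trans (leq_mul (leq_card_bigcup _ _) (leqnn _)) _.
have -> : 'C('C(k, 2), m) = #|Fs S| by rewrite cards_draws cards_draws Sk.
rewrite -sum_nat_const big_distrl /=.
apply: leq_sum => F; rewrite inE => /andP[/fintype.subsetP FS /eqP Fm].
rewrite -Fm; apply: (@card_regular_containing _ S); last by rewrite Sk.
by move=> e /FS; rewrite inE => /andP[? /eqP].
Qed.
End union_bound.

Section sparsity.
Variable R : realType.

(** One term of the binomial expansion of (1 + x)^n, which is at most exp(n x).
    The choice x = k / n gives the usual bound (e n / k)^k. *)
Lemma bin_le_expR n k (x : R) : 0 <= x ->
  'C(n, k)%:R * x ^+ k <= expR (n%:R * x).
Proof.
move=> x0; rewrite expRM_natl.
apply: le_trans (_ : (1 + x) ^+ n <= _); last first.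
  by rewrite lerXn2r ?nnegrE ?expR_ge0 ?addr_ge0 // expR_ge1Dx.
have [kn|nk] := leqP k n; last by rewrite bin_small // mul0r exprn_ge0 // addr_ge0.
rewrite exprDn (bigD1 (Ordinal (kn : (k < n.+1)%N))) //= expr1n mul1r mulr_natl.
rewrite lerDl; apply: sumr_ge0 => i _.
by rewrite mulrn_wge0 // mulr_ge0 // exprn_ge0.
Qed.

Definition sparse_below (eta : R) (L : nat) (V : finType) (E : {set {set V}}) :=
  [forall S : {set V}, (#|S|%:R <= eta * #|V|%:R) ==>
     (L * #|[set e in E | e \subset S]%SET| <= L.+1 * #|S|)%N].

(** The union bound for sets of [k] vertices is at most
    [switch_const d ^+ k * (k / n) ^+ (m - k)] if [m <= 3 * k]: the two binomial
    coefficients contribute a factor e^2 per vertex and switching a factor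
    [2 * d] per edge. *)
Definition switch_const (d : nat) : R := expR 2 * (2 * d)%:R ^+ 3.

(** The fraction of the vertices below which the factor [(k / n) ^+ (m - k)],
    with [m - k] at least [k / L], beats [(4 * switch_const d) ^+ k]. *)
Definition sparse_scale (d L : nat) : R := (4 * switch_const d) ^- L.

Lemma switch_const_ge1 d : (0 < d)%N -> 1 <= switch_const d.
Proof.
move=> d0; rewrite /switch_const mulr_ege1 //; first by rewrite -expR0 ler_expR.
by rewrite exprn_ege1 // ler1n; lia.
Qed.

(** Since [m] exceeds [k] by [k %/ L + 1], one factor [k / n] gives the decay in
    [n], and [k %/ L] further ones, each at most [sparse_scale d L], pay for
    [switch_const d ^+ k] and leave 4^-k, which absorbs [k <= 2 ^ k]. *)
Lemma dense_weight (n d k L : nat) :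
  let m := (k + k %/ L + 1)%N in
  (0 < d)%N -> (0 < L)%N -> (0 < k)%N -> (0 < n)%N ->
  k%:R <= sparse_scale d L * n%:R ->
  ('C(n, k) * 'C('C(k, 2), m) * (2 * d) ^ m)%:R / n%:R ^+ m
    <= (4 * switch_const d) ^+ L / n%:R * 2^-1 ^+ k.
Proof.
move=> m d0 L0 k0 n0; rewrite /sparse_scale.
have := switch_const_ge1 d0; have [A AE] : exists A, A = switch_const d by eexists.
rewrite -AE => A1 small.
have A0 : 0 < A := lt_le_trans ltr01 A1.
have kR : 0 < k%:R :> R by rewrite ltr0n.
have nR : 0 < n%:R :> R by rewrite ltr0n.
have b1 : 'C(n, k)%:R <= (expR 1 : R) ^+ k * (n%:R / k%:R) ^+ k.
  have := @bin_le_expR n k (k%:R / n%:R) (divr_ge0 (ltW kR) (ltW nR)).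
  have -> : n%:R * (k%:R / n%:R) = k%:R * 1 :> R by rewrite mulrCA divff ?gt_eqF.
  rewrite expRM_natl => b.
  have -> : n%:R / k%:R = (k%:R / n%:R)^-1 :> R by rewrite invf_div.
  by rewrite exprVn ler_pdivlMr // exprn_gt0 // divr_gt0.
have b2 : 'C('C(k, 2), m)%:R <= (expR 1 : R) ^+ k * k%:R ^+ m.
  have := @bin_le_expR 'C(k, 2) m k%:R^-1; rewrite invr_ge0 ltW // => /(_ isT) b.
  rewrite -ler_pdivrMr ?exprn_gt0 // -exprVn; apply: le_trans b _.
  rewrite -expRM_natl mulr1 ler_expR ler_pdivrMr // -natrM ler_nat bin2.
  by rewrite leq_half_double; nia.
have [j jE] : exists j, j = (k %/ L + 1)%N by eexists.
have mE : m = (k + j)%N by rewrite /m jE addnA.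
have m3 : (m <= 3 * k)%N by rewrite /m; have := leq_div k L; lia.
have kLj : (k <= L * j)%N.
  by rewrite {1}(divn_eq k L) jE mulnDr muln1 mulnC leq_add2l ltnW // ltn_pmod.
have [D DE] : exists D, (2 * d)%N = D by eexists.
rewrite DE.
have d1 : 1 <= D%:R :> R by rewrite ler1n -DE; lia.
have dR : 0 < D%:R :> R := lt_le_trans ltr01 d1.
have step1 : ('C(n, k) * 'C('C(k, 2), m) * D ^ m)%:R / n%:R ^+ m
    <= (expR 2 : R) ^+ k * D%:R ^+ m * (k%:R / n%:R) ^+ j.
  rewrite !natrM natrX ler_pdivrMr ?exprn_gt0 //.
  have -> : (expR 2 : R) ^+ k * D%:R ^+ m * (k%:R / n%:R) ^+ j * n%:R ^+ m =
     (expR 1 ^+ k * (n%:R / k%:R) ^+ k) * (expR 1 ^+ k * k%:R ^+ m) * D%:R ^+ m.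
    have -> : expR 2 = expR 1 * expR 1 :> R by rewrite -expRD.
    have kk0 : k%:R ^+ k != 0 :> R by rewrite expf_neq0 ?gt_eqF.
    have nj0 : n%:R ^+ j != 0 :> R by rewrite expf_neq0 ?gt_eqF.
    rewrite mE !exprMn !exprVn !exprD.
    move: (k%:R ^+ k) (n%:R ^+ j) kk0 nj0 (expR 1 ^+ k) (n%:R ^+ k)
      (k%:R ^+ j) (D%:R ^+ k) (D%:R ^+ j) => a b a0 b0 c e f g h; field.
    by rewrite a0.
  rewrite ler_wpM2r ?exprn_ge0 ?ler0n //.
  by apply: ler_pM; rewrite ?ler0n.
have step2 : (expR 2 : R) ^+ k * D%:R ^+ m <= (A ^+ L) ^+ j.
  rewrite -exprM; apply: le_trans (_ : A ^+ k <= _); last by rewrite ler_weXn2l.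
  rewrite AE /switch_const DE exprMn -exprM ler_wpM2l ?exprn_ge0 ?expR_ge0 //.
  by rewrite ler_weXn2l.
pose u := A ^+ L * (k%:R / n%:R).
have u0 : 0 <= u by rewrite mulr_ge0 ?exprn_ge0 ?divr_ge0 // ltW.
have u4 : u <= 4^-1 ^+ L.
  have -> : 4^-1 ^+ L = A ^+ L * (4 * A) ^- L.
    by rewrite exprMn invfM mulrCA divff ?mulr1 ?exprVn // expf_neq0 ?gt_eqF.
  by rewrite ler_wpM2l ?exprn_ge0 ?(ltW A0) // ler_pdivrMr.
have uj : u ^+ (k %/ L) <= 4 ^+ L * 4^-1 ^+ k.
  apply: le_trans (_ : (4^-1 ^+ L) ^+ (k %/ L) <= _).
    by rewrite lerXn2r ?nnegrE // exprn_ge0.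
  rewrite -exprM !exprVn ler_pdivlMr ?exprn_gt0 // mulrC ler_pdivrMr ?exprn_gt0 //.
  rewrite -exprD ler_weXn2l // ?ler1n //.
  by move: kLj; rewrite jE mulnDr muln1 addnC.
apply: le_trans step1 _.
apply: le_trans (_ : u ^+ j <= _).
  rewrite /u [(A ^+ L * _) ^+ j]exprMn ler_wpM2r ?exprn_ge0 ?divr_ge0 ?ler0n //.
rewrite jE addn1 exprS.
apply: le_trans (ler_wpM2l u0 uj) _.
have -> : u * (4 ^+ L * 4^-1 ^+ k) = (4 * A) ^+ L / n%:R * (k%:R * 4^-1 ^+ k).
  by rewrite /u exprMn; ring.
rewrite ler_wpM2l ?divr_ge0 ?exprn_ge0 ?mulr_ge0 // ?(ltW A0) //.
have -> : 4^-1 = 2^-1 * 2^-1 :> R by rewrite -invfM -natrM.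
rewrite exprMn mulrA ler_piMl ?exprn_ge0 // exprVn ler_pdivrMr ?exprn_gt0 //.
by rewrite mul1r -natrX ler_nat ltnW // ltn_expl.
Qed.

Lemma sum_half_powers n : \sum_(k < n) 2^-1 ^+ k <= 2 :> R.
Proof.
suff -> : \sum_(k < n) 2^-1 ^+ k = 2 - 2 * 2^-1 ^+ n :> R.
  by rewrite gerBl mulr_ge0 // exprn_ge0.
elim: n => [|n IHn]; first by rewrite big_ord0 expr0; lra.
rewrite big_ord_recr /= IHn exprS; lra.
Qed.

(** A set of size [k] that violates sparsity contains at least [k + k %/ L + 1]
    edges.  The bounds [dense_weight] are summed over [k] as a geometric
    series. *)
Lemma card_not_sparse (V : finType) (d L : nat) :
  (0 < d)%N -> (0 < L)%N -> (8 * d + 4 <= #|V|)%N ->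
  #|[set E : {set {set V}} | edge_set_regular d E
       & ~~ sparse_below (sparse_scale d L) L E]%SET|%:R
   <= (4 * switch_const d) ^+ L * 2 / #|V|%:R
      * #|regular_edge_sets V d|%:R :> R.
Proof.
move=> d0 L0 nbig; set n := #|V|; set a := #|regular_edge_sets V d|.
have n0 : (0 < n)%N by rewrite /n; lia.
have nR : 0 < n%:R :> R by rewrite ltr0n.
have := switch_const_ge1 d0; have weight := @dense_weight n d _ L d0 L0.
move: weight; rewrite /sparse_scale; move: (switch_const d) => A weight A1.
have A0 : 0 < A := lt_le_trans ltr01 A1.
pose small (k : nat) := k%:R <= (4 * A) ^- L * n%:R.
have smallP k : small k -> (n <= 2 * (n - (k + 2 * d + 1)))%N.
  move=> ks; suff : (4 * k <= n)%N by rewrite /n in nbig *; lia.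
  rewrite -(ler_nat R) natrM; apply: le_trans (ler_wpM2l _ ks) _ => //.
  rewrite mulrA ler_piMl ?ler0n // /sparse_scale ler_pdivrMr ?exprn_gt0 ?mulr_gt0 //.
  rewrite mul1r -(prednK L0) exprS -[X in X <= _]mulr1.
  apply: ler_pM => //; first by rewrite ler_peMr.
  by rewrite exprn_ege1 // mulr_ege1 // ler1n.
pose K := [set k : 'I_n.+1 | (0 < k)%N && small k]%SET.
have sub : [set E : {set {set V}} | edge_set_regular d E
              & ~~ sparse_below ((4 * A) ^- L) L E]%SET
    \subset (\bigcup_(k in K) has_dense_set V d k (k + k %/ L + 1))%SET.
  apply/fintype.subsetP => E; rewrite inE => /andP[Ereg].
  rewrite negb_forall => /existsP[S]; rewrite negb_imply -ltnNge.
  move=> /andP[Ssmall dense].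
  have Sn : (#|S| < n.+1)%N by rewrite ltnS max_card.
  apply/finset.bigcupP; exists (Ordinal Sn).
    rewrite inE; apply/andP; split; last exact: Ssmall.
    rewrite /= card_gt0; apply: contraTneq dense => ->.
    rewrite cards0 muln0 -leqNgt [#|_|](_ : _ = 0%N) ?muln0 //.
    apply: eq_card0 => e; rewrite !inE; apply/negP => /andP[eE].
    rewrite finset.subset0 => /eqP e0; have /andP[/forallP/(_ e)] := Ereg.
    by rewrite eE e0 cards0.
  rewrite inE Ereg /=; apply/existsP; exists S; rewrite eqxx /=.
  move: dense; move: #|[set _ in E | _]%SET| #|S| => b c.
  by rewrite addn1 -ltn_subRL ltn_divLR // mulnBl => dense; rewrite ltn_subRL; lia.
have card1 : (#|[set E : {set {set V}} | edge_set_regular d E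
      & ~~ sparse_below ((4 * A) ^- L) L E]%SET|%:R
    <= \sum_(k in K) #|has_dense_set V d k (k + k %/ L + 1)|%:R :> R).
  rewrite -natr_sum ler_nat.
  exact: leq_trans (subset_leq_card sub) (leq_card_bigcup _ _).
apply: le_trans card1 _.
have term (k : 'I_n.+1) : k \in K ->
   #|has_dense_set V d k (k + k %/ L + 1)|%:R <=
   (4 * A) ^+ L / n%:R * a%:R * 2^-1 ^+ k.
  rewrite inE => /andP[k0 ks].
  have := card_has_dense_set (k + k %/ L + 1) (smallP _ ks).
  rewrite -(ler_nat R) natrM [in X in _ <= X]natrM natrX -ler_pdivlMr ?exprn_gt0 //.
  move=> le1; apply: le_trans le1 _.
  rewrite mulrAC [X in _ <= X]mulrAC ler_wpM2r //.
  exact: weight.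
apply: le_trans (ler_sum _ term) _.
rewrite -mulr_sumr.
have -> : (4 * A) ^+ L * 2 / n%:R * a%:R =
  (4 * A) ^+ L / n%:R * a%:R * 2 by ring.
rewrite ler_wpM2l ?mulr_ge0 ?invr_ge0 ?exprn_ge0 ?mulr_ge0 ?(ltW A0) ?ler0n //.
apply: le_trans (sum_half_powers n.+1); rewrite big_mkcond /=.
by apply: ler_sum => k _; case: ifP => // _; rewrite exprn_ge0.
Qed.

End sparsity.

(** * Regular graphs of every admissible order *)

Section existence.

Lemma ord_opp_fix n (a : 'I_n.+1) : - a = a -> a = 0 \/ a = inord (n.+1)./2.
Proof.
move=> /(congr1 val) /= aN; have [a0|a0] := posnP a; first by left; apply: val_inj.
right; apply: val_inj; have an := ltn_ord a.
rewrite modn_small in aN; last by lia.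
by rewrite /= inordK; lia.
Qed.

(** Elements are added in pairs [a], [- a]; an odd cardinal starts from the
    element of order two, which exists as the group then has even order. *)
Lemma symmetric_set n d : ~~ odd (n.+1 * d) -> (d + 2 <= n.+1)%N ->
  exists A : {set 'I_n.+1},
    [/\ #|A| = d, 0 \notin A & forall a, a \in A -> - a \in A].
Proof.
have [m] := ubnP d; elim: m d => // m IHm [|[|d]] dm even_nd dn.
- by exists finset.set0; rewrite cards0 inE; split => // a; rewrite inE.
- exists [set inord (n.+1)./2]%SET; rewrite cards1.
  have half : (inord (n.+1)./2 : 'I_n.+1) = (n.+1)./2 :> nat.
    by rewrite inordK //; lia.
  split => //.
    rewrite inE; apply/eqP => /(congr1 val) /=; rewrite half.
    by move: dn => /=; lia.
  move=> a; rewrite !inE => /eqP ->; apply/eqP; apply: val_inj.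
  rewrite /= half modn_small; move: even_nd; rewrite muln1; lia.
- have [|||A [cA A0 Aopp]] := IHm d;
    try by move: even_nd dm dn; rewrite ?oddM /= ?negbK; lia.
  have : (0 < #|~: (A :|: [set 0%R; inord (n.+1)./2])%SET|)%N.
    rewrite cardsCs finset.setCK card_ord subn_gt0.
    apply: leq_ltn_trans (leq_card_setU _ _) _; rewrite cA cards2.
    by apply: leq_ltn_trans (leq_add (leqnn _) (_ : _ <= 2)%N) _; [case: eqP|lia].
  case/card_gt0P => a; rewrite !inE !negb_or => /and3P[aA a0 ahalf].
  have a_opp : a != - a.
    apply/eqP => /esym /ord_opp_fix[] /eqP; first by rewrite (negPf a0).
    by rewrite (negPf ahalf).
  have oppA : - a \notin A by apply: contra aA => /Aopp; rewrite opprK.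
  exists (a |: (- a |: A))%SET; split.
  + by rewrite !cardsU1 !inE negb_or a_opp aA oppA cA.
  + by rewrite !inE !negb_or eq_sym a0 eq_sym oppr_eq0 a0.
  + move=> b; rewrite !inE eqr_opp.
    case/or3P => [/eqP ->|/eqP ->|/Aopp ->]; rewrite ?eqxx ?orbT //.
    by rewrite opprK eqxx.
Qed.

(** A circulant graph: [x] and [y] are adjacent if their difference belongs to a
    symmetric set of [d] nonzero elements of the cyclic group. *)
Lemma regular_edge_set_exists n d : ~~ odd (n * d) -> (d + 2 <= n)%N ->
  exists E : {set {set 'I_n}}, edge_set_regular d E.
Proof.
case: n => [|n]; first by rewrite addn2.
move=> even_nd dn; have [A [cA A0 Aopp]] := symmetric_set even_nd dn.
pose E := [set e : {set 'I_n.+1} |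
  [exists x, exists y, (e == [set x; y]%SET) && (y - x \in A)]]%SET.
have EP x y : ([set x; y]%SET \in E) = (y - x \in A).
  rewrite inE; apply/idP/idP => [|yxA]; last first.
    by apply/existsP; exists x; apply/existsP; exists y; rewrite eqxx.
  move=> /existsP[x' /existsP[y' /andP[/eqP exy yxA]]].
  have := set21 x y; have := set22 x y; rewrite exy !in_set2.
  have := set21 x' y'; have := set22 x' y'; rewrite -exy !in_set2.
  have yxA' := Aopp _ yxA; rewrite opprB in yxA'.
  by do 4![case/orP => /eqP ?]; subst.
exists E; have E2 : [forall e in E, #|e| == 2%N].
  apply/forallP => e; apply/implyP; rewrite inE.
  move=> /existsP[x /existsP[y /andP[/eqP -> yxA]]]; rewrite cards2.
  by have [yx|//] := eqVneq x y; move: yxA; rewrite yx subrr (negPf A0).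
rewrite /edge_set_regular E2; apply/forallP => x; rewrite card_incident //.
have <- : #|(fun y => y - x) @^-1: A| = d.
  by rewrite -cA; apply: card_preimset; exact: addIr.
by apply/eqP; apply: eq_card => y; rewrite [LHS]inE EP [RHS]inE.
Qed.

End existence.

Lemma card_regular_sgraph (V : finType) (d : nat) (P : pred {set {set V}}) :
  #|[set G : sgraph V | P (edges G) & regular d G]%SET| =
  #|[set E : {set {set V}} | edge_set_regular d E & P E]%SET|.
Proof.
rewrite -(card_imset _ (@val_inj _ _ (sgraph V))); apply: eq_card => E.
rewrite [RHS]inE; apply/imsetP/andP => [[G + ->]|[/andP[E2 Ed] PE]].
  rewrite inE => /andP[PG Gd]; split=> //.
  by rewrite /edge_set_regular (edges_card2 G).
by exists (SGraph E2) => //; rewrite inE PE.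
Qed.

(** * Macroscopic cycles *)

Lemma handshake (V : finType) (d : nat) (G : sgraph V) :
  regular d G -> (#|edges G| * 2 = #|V| * d)%N.
Proof.
move=> /forallP Gd; have /forallP E2 := edges_card2 G.
have -> : (#|V| * d = \sum_(v : V) degree G v)%N.
  by rewrite (eq_bigr (fun=> d)) => [|v _]; [rewrite sum_nat_const | exact/eqP/Gd].
have deg v : degree G v = (\sum_(e in edges G) (v \in e))%N.
  rewrite /degree -sum1_card big_mkcond [RHS]big_mkcond /=; apply: eq_bigr => e _.
  by rewrite inE; case: (e \in edges G) => //=; case: (v \in e).
under eq_bigr => v _ do rewrite deg.
rewrite exchange_big /= -sum_nat_const; apply: eq_bigr => e eG.
have := E2 e; rewrite eG /= => /eqP <-.
by rewrite -sum1_card [LHS]big_mkcond /=; apply: eq_bigr => v _; case: (v \in e).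
Qed.

Lemma card_inside_cycle (V : finType) (E : {set {set V}}) (a : {perm V}) :
  (#|[set e in E | inside_cycle a e]%SET|
    <= \sum_(O in porbits a) #|[set e in E | e \subset O]%SET|)%N.
Proof.
apply: leq_trans (leq_card_bigcup _ _); apply: subset_leq_card.
apply/fintype.subsetP => e; rewrite inE => /andP[eE /existsP[x ex]].
apply/finset.bigcupP; exists (porbit a x); first exact: imset_f.
by rewrite inE eE.
Qed.

Section large_cycles.
Variables (R : realType) (V : finType) (G : sgraph V).

Definition has_large_cycle (eta : R) (a : {perm V}) : bool :=
  [exists C in porbits a, eta * #|V|%:R < #|C|%:R].

Lemma inside_cycle_sparse (eta : R) L a :
  sparse_below eta L (edges G) -> ~~ has_large_cycle eta a ->
  (L * #|[set e in edges G | inside_cycle a e]%SET| <= L.+1 * #|V|)%N.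
Proof.
move=> /forallP Gsparse; rewrite negb_exists => /forallP small.
apply: leq_trans (leq_mul (leqnn _) (card_inside_cycle _ _)) _.
rewrite -[#|V|]cardsT (card_partition (porbits_partition a)) !big_distrr /=.
apply: leq_sum => O Oa; have := small O; rewrite Oa /= -leNgt.
exact: implyP (Gsparse O).
Qed.

Lemma weighted_prob_sum (X : interchange_process R G)
    (p : R -> {perm V} -> {perm V} -> R) (k : nat) (t eta : R) :
  (forall a, ip_prob X (ip_path X t @^-1` [set a]) = (p t 1%g a)%:E) -> 0 <= t ->
  weighted_prob X k%:R t (large_cycle X t eta) =
  (\sum_a p t 1%g a * k%:R ^+ ncycles a)^-1 *
  \sum_a p t 1%g a * (k%:R ^+ ncycles a * (has_large_cycle eta a)%:R).
Proof.
move=> law t0; have mjp := ip_markov X.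
rewrite /weighted_prob /partition_function; congr (_^-1 * _).
  by apply: (mjp_expectation mjp law t0 (g := fun a => k%:R ^+ ncycles a)) => a;
    rewrite exprn_ge0.
have g0 a : 0 <= k%:R ^+ ncycles a * (has_large_cycle eta a)%:R :> R.
  by rewrite mulr_ge0 // exprn_ge0.
rewrite -(mjp_expectation mjp law t0 g0).
congr (fine 'E_(_)[_]); apply/funext => w; congr (_ * _).
rewrite indicE; congr (_%:R); apply: congr1; apply/idP/idP.
  by rewrite inE => -[C CX big]; apply/existsP; exists C; rewrite CX.
by case/existsP => C /andP[CX big]; rewrite inE; exists C.
Qed.

(** The lower bound [fix_mean_slope] confronted with [interchange_slope], both
    divided by the number of vertices.  The edges inside cycles number at most
    [(1 + 1 / L) * #|V|] unless there is a large cycle, in which case all the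
    [#|V| * d / 2] edges may be inside. *)
Lemma slope_bound (X : interchange_process R G) (k d L : nat) (t eta : R) :
  (2 <= k)%N -> (0 < L)%N -> (0 < #|V|)%N -> 0 < t ->
  regular d G -> sparse_below eta L (edges G) ->
  - ln k%:R <= t * ((k%:R - k%:R^-1) * (1 + L%:R^-1
      + weighted_prob X k%:R t (large_cycle X t eta) * (d%:R / 2))
      - (1 - k%:R^-1) * (d%:R / 2)).
Proof.
move=> k2 L0 V0 t0 Gd Gsparse.
have k0 : (0 < k)%N by lia.
have [p [tp rate law]] := mjp_law (ip_markov X).
have lawt a := law t a (ltW t0).
rewrite (@weighted_prob_sum X p k t eta lawt (ltW t0)).
have fixgt0 a : (0 < #|afix (colour_action V k) [set a]%SET|)%N.
  by rewrite card_fix_colour // expn_gt0 k0.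
have slope := fix_mean_slope (@rate_lmul V R G) (@rate_sym V R G) tp rate fixgt0 t0.
have Z1 := fix_mean_ge1 tp fixgt0 (ltW t0).
have ZE : fix_mean p (colour_action V k) t = \sum_a p t 1%g a * k%:R ^+ ncycles a.
  by apply: eq_bigr => a _; rewrite card_fix_colour // natrX.
move: slope Z1; rewrite ZE card_ffun card_ord natrX lnXn ?ltr0n //.
set Z := \sum_a _ * _ ^+ _; set B := \sum_a p t 1%g a * (_ * _) => slope Z1.
have Z0 : 0 < Z := lt_le_trans ltr01 Z1.
have nR : 0 < #|V|%:R :> R by rewrite ltr0n.
have LR : 0 < L%:R :> R by rewrite ltr0n.
have kR : 1 < k%:R :> R by rewrite ltr1n.
have EG : #|edges G|%:R = #|V|%:R * (d%:R / 2) :> R.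
  have := congr1 (fun m => m%:R : R) (handshake Gd); rewrite /= !natrM => h.
  by rewrite mulrA -h mulfK.
have c0 : 0 <= k%:R - k%:R^-1 :> R.
  by rewrite subr_ge0 (le_trans _ (ltW kR)) // invf_le1 ?ltW // ltr0n.
have sum_le :
  \sum_a p t 1%g a * fix_slope (interchange_rate R G) (colour_action V k) a
   <= #|V|%:R * (((k%:R - k%:R^-1) * (1 + L%:R^-1) - (1 - k%:R^-1) * (d%:R / 2)) * Z
                 + (k%:R - k%:R^-1) * (d%:R / 2) * B).
  rewrite mulrDr !mulrA 2!mulr_sumr -big_split /=; apply: ler_sum => a _.
  rewrite interchange_slope // EG.
  set S := #|_|%:R; set u := k%:R ^+ _; set q := p _ _ _.
  have qu0 : 0 <= q * u by rewrite mulr_ge0 ?(tf_ge0 tp) ?exprn_ge0 // ltW.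
  have S_le : S <= #|V|%:R * (1 + L%:R^-1)
                   + #|V|%:R * (d%:R / 2) * (has_large_cycle eta a)%:R.
    have [big|small] := boolP (has_large_cycle eta a).
      rewrite mulr1 -EG ler_wpDl ?mulr_ge0 ?addr_ge0 ?invr_ge0 //.
      rewrite /S ler_nat; apply: subset_leq_card.
      by apply/fintype.subsetP => e; rewrite inE => /andP[].
    rewrite mulr0 addr0; have := inside_cycle_sparse Gsparse small.
    rewrite -(ler_nat R) !natrM -/S -natr1 => h.
    rewrite -(ler_pM2l LR); apply: le_trans h _.
    rewrite le_eqVlt; apply/orP; left; apply/eqP.
    by rewrite mulrCA mulrDr mulr1 divff ?gt_eqF // mulrC.
  have := ler_wpM2l c0 S_le; move/(ler_wpM2l qu0) => h.
  rewrite -subr_ge0 in h; rewrite -subr_ge0; apply: le_trans h _.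
  by rewrite le_eqVlt; apply/orP; left; apply/eqP; ring.
have step : - (ln k%:R *+ #|V|) <= t * (#|V|%:R * (((k%:R - k%:R^-1) * (1 + L%:R^-1)
      - (1 - k%:R^-1) * (d%:R / 2)) * Z + (k%:R - k%:R^-1) * (d%:R / 2) * B) / Z).
  apply: le_trans slope _; rewrite ler_wpM2l ?(ltW t0) //.
  by rewrite ler_wpM2r ?invr_ge0 ?(ltW Z0).
have Zn0 : Z != 0 by rewrite gt_eqF.
rewrite -(ler_pM2l nR); have -> : #|V|%:R * - ln k%:R = - (ln k%:R *+ #|V|) :> R.
  by rewrite mulrN mulr_natl.
apply: le_trans step _; rewrite le_eqVlt; apply/orP; left; apply/eqP.
clear -Zn0.
move: (k%:R - _) (L%:R^-1) (d%:R / 2) (1 - _) (#|V|%:R) Z B Zn0 => c l D e n z b z0.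
by field.
Qed.
End large_cycles.

(** For [L] infinite and [w] zero, the strict inequality is equivalent to
    [T_threshold R k d < t]; it leaves room for small [1 / L] and [w]. *)
Lemma threshold_gap (R : realType) (k d : nat) (t : R) :
  (2 <= k)%N -> (2 * (1 + k) < d)%N -> T_threshold R k d < t ->
  exists (epsilon : R) (L : nat), [/\ 0 < epsilon, (0 < L)%N, 0 < t &
    forall w : R, w < epsilon ->
      t * ((k%:R - k%:R^-1) * (1 + L%:R^-1 + w * (d%:R / 2))
           - (1 - k%:R^-1) * (d%:R / 2)) < - ln k%:R].
Proof.
move=> k2 dk; rewrite /T_threshold => Tt.
have kR : 1 < k%:R :> R by rewrite ltr1n.
have k0 : 0 < k%:R :> R := lt_trans ltr01 kR.
have dR : 2 * (1 + k%:R) < d%:R :> R by rewrite -(natrD _ 1%N) -natrM ltr_nat.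
have d0 : 0 < d%:R :> R by apply: lt_trans dR; rewrite mulr_gt0 // addr_gt0.
have lnk : 0 < ln k%:R :> R by rewrite ln_gt0.
have den : 0 < (k%:R - 1) * (d%:R - 2 * (1 + k%:R)) :> R.
  by rewrite mulr_gt0 // subr_gt0.
have t0 : 0 < t.
  apply: lt_trans Tt; rewrite divr_gt0 // mulr_gt0 // mulr_gt0 //.
move: Tt; rewrite ltr_pdivrMr // => Tt.
pose c : R := 1 - k%:R^-1.
have c0 : 0 < c by rewrite subr_gt0 invf_lt1.
have ck : k%:R - k%:R^-1 = c * (k%:R + 1).
  by rewrite /c; field; rewrite gt_eqF.
pose gap := t * c * (d%:R / 2 - (k%:R + 1)) - ln k%:R.
have gap0 : 0 < gap.
  rewrite -(pmulr_rgt0 _ (mulr_gt0 (ltr0n _ 2 : 0 < 2) k0)).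
  have -> : 2 * k%:R * gap = t * ((k%:R - 1) * (d%:R - 2 * (1 + k%:R)))
                             - 2 * k%:R * ln k%:R.
    by rewrite /gap /c; field; rewrite gt_eqF.
  by rewrite subr_gt0.
pose b := t * c * (k%:R + 1).
have b0 : 0 < b by rewrite !mulr_gt0 // addr_gt0.
exists (gap / (b * d%:R)), (Num.truncn (2 * b / gap)).+1.
set L := (Num.truncn _).+1; have LR : 0 < L%:R :> R by rewrite ltr0n.
split=> // [|w we]; first by rewrite divr_gt0 // mulr_gt0.
have Lb : b * L%:R^-1 < gap / 2.
  rewrite ltr_pdivrMr // mulrAC ltr_pdivlMr // mulrC [gap * _]mulrC.
  by rewrite -ltr_pdivrMr //; exact: truncnS_gt.
have wb : b * (w * (d%:R / 2)) < gap / 2.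
  have : w * (b * d%:R) < gap by rewrite -ltr_pdivlMr // mulr_gt0.
  have -> : b * (w * (d%:R / 2)) = w * (b * d%:R) / 2 by ring.
  by rewrite ltr_pM2r // invr_gt0.
rewrite ck -/c.
have -> : t * (c * (k%:R + 1) * (1 + L%:R^-1 + w * (d%:R / 2)) - c * (d%:R / 2))
   = b * L%:R^-1 + b * (w * (d%:R / 2)) - gap - ln k%:R.
  rewrite /gap /b; ring.
lra.
Qed.

Lemma p_regular_le1 (R : realType) (n d : nat) (A : {set sgraph 'I_n}) :
  p_regular R d A <= 1.
Proof.
rewrite /p_regular; set m := #|[set G : sgraph 'I_n | regular d G]%SET|.
have [->|m0] := posnP m; first by rewrite invr0 mulr0.
rewrite ler_pdivrMr ?ltr0n // mul1r ler_nat; apply: subset_leq_card.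
by apply/fintype.subsetP => G; rewrite !inE => /andP[].
Qed.

(** The complement is controlled by [card_not_sparse], and the denominator is not
    0 by [regular_edge_set_exists]. *)
Lemma p_regular_sparse (R : realType) (n d L : nat) (A : {set sgraph 'I_n}) :
  (0 < d)%N -> (0 < L)%N -> (8 * d + 4 <= n)%N -> ~~ odd (n * d) ->
  (forall G, regular d G ->
     sparse_below (sparse_scale R d L) L (edges G) -> G \in A) ->
  1 - (4 * switch_const R d) ^+ L * 2 / n%:R <= p_regular R d A.
Proof.
move=> d0 L0 nbig even_nd sparseA.
pose sp (E : {set {set 'I_n}}) := sparse_below (sparse_scale R d L) L E.
have := @card_not_sparse R 'I_n d L d0 L0; rewrite card_ord => /(_ nbig).
rewrite -(card_regular_sgraph d (fun E => ~~ sp E)).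
have -> : #|regular_edge_sets 'I_n d| =
          #|[set G : sgraph 'I_n | regular d G]%SET|.
  transitivity #|[set G : sgraph 'I_n | predT (edges G) & regular d G]%SET|.
    rewrite (card_regular_sgraph d predT); apply: eq_card => E.
    by rewrite !inE andbT.
  by apply: eq_card => G; rewrite !inE.
set reg := #|[set G : sgraph 'I_n | regular d G]%SET|; set bad := #|_|.
have reg0 : (0 < reg)%N.
  have [E Ereg] := @regular_edge_set_exists n d even_nd ltac:(lia).
  have : (0 < #|[set G : sgraph 'I_n | predT (edges G) & regular d G]%SET|)%N.
    rewrite card_regular_sgraph card_gt0; apply/set0Pn; exists E.
    by rewrite inE Ereg.
  by congr (0 < _)%N; apply: eq_card => G; rewrite !inE.
move=> bad_le; rewrite /p_regular -/reg ler_pdivlMr ?ltr0n //.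
rewrite mulrBl mul1r lerBlDr; apply: le_trans (lerD (lexx _) bad_le).
rewrite -natrD ler_nat /reg /bad; apply: leq_trans (leq_card_setU _ _).
apply: subset_leq_card; apply/fintype.subsetP => G; rewrite !inE => Gd.
by rewrite Gd !andbT; have [/(sparseA _ Gd) ->|_] := boolP (sp (edges G));
  rewrite ?orbT.
Qed.

Theorem theorem1 (R : realType) (theta d : nat) (t : R) :
  (2 <= theta)%N -> (2 * (1 + theta) < d)%N -> T_threshold R theta d < t ->
  exists epsilon eta : R, 0 < epsilon /\ 0 < eta /\
    forall X : forall (n : nat) (G : sgraph 'I_n), interchange_process R G,
      p_regular R d [set G : sgraph 'I_n |
        epsilon <= weighted_prob (X n G) theta%:R t (large_cycle (X n G) t eta)]%SET
      @[n --> within [set n | ~~ odd (n * d)] \oo] --> (1 : R).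
Proof.
move=> theta2 d_big /(threshold_gap theta2 d_big)[eps [L [eps0 L0 t0 gap]]].
have d0 : (0 < d)%N by lia.
exists eps, (sparse_scale R d L); split=> //; split.
  rewrite invr_gt0 exprn_gt0 // mulr_gt0 //.
  exact: lt_le_trans ltr01 (switch_const_ge1 R d0).
move=> X; apply/cvgrPdist_le => e e0.
rewrite near_withinE; near=> n => even_nd.
have nbig : (8 * d + 4 <= n)%N by near: n; exact: nbhs_infty_ge.
rewrite ger0_norm ?subr_ge0 ?p_regular_le1 //.
rewrite lerBlDr addrC -lerBlDr; apply: le_trans (lerB (lexx 1) _) _; last first.
  apply: (@p_regular_sparse R n d L) => // G Gd Gsparse.
  rewrite inE leNgt; apply/negP => /gap; apply/negP; rewrite -leNgt.
  apply: slope_bound => //.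
  rewrite card_ord; lia.
rewrite ler_pdivrMr; last by rewrite ltr0n; lia.
by rewrite -ler_pdivrMl //; near: n; exact: nbhs_infty_ger.
Unshelve. all: by end_near.
Qed.
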